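(* For every integer $n\geq 0$ and every integer $k$ with $0\leq k\leq n$, one has $v_{n,k}>0$.
   Context: Let $(P_n)_{n\ge 0}$, $\deg P_n=n$, be the orthogonal polynomials on $(-1,1)$ with respect to the even weight $\frac{\arcsin x}{x}\,\mathrm{d}x$ (density extended continuously at $x=0$), normalized by $P_n(1)=1$. For each $n\ge 0$ the real numbers $v_{n,0},\dots,v_{n,n}$ are defined by the identity $$e^{in\theta}P_n(\cos\theta)=\sum_{k=0}^n v_{n,k}e^{2ik\theta}\qquad(\theta\in\mathbb R).$$ *)

(* Defs.v *)
From HB Require Import structures.
From mathcomp Require Import all_boot all_order all_algebra.
From mathcomp Require Import complex.
From mathcomp Require Import all_classical all_reals all_analysis.

Set Implicit Arguments.
Unset Strict Implicit.
Unset Printing Implicit Defensive.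

Import Order.TTheory GRing.Theory Num.Theory.
Import numFieldNormedType.Exports.

Local Open Scope classical_set_scope.
Local Open Scope ring_scope.

(* The value 1 at the origin is the limit of [asin x / x]. *)
Definition arcsin_weight (R : realType) (x : R) : R :=
  if x == 0 then 1 else asin x / x.

(* [size p = n.+1] means that [p] has degree exactly [n].  When [w] is
   integrable on ]-1, 1[ all the integrands are integrable, so the real-valued
   integral, which would be 0 on an infinite or undefined integral, is genuine. *)
Definition is_normalized_orthopoly (R : realType) (w : R -> R)
    (P : nat -> {poly R}) : Prop :=
  [/\ forall n, size (P n) = n.+1,
      forall m n, m <> n ->
        (\int[lebesgue_measure]_(x in `]-1, 1[) ((P m).[x] * (P n).[x] * w x))%R
          = 0 &
      forall n, (P n).[1] = 1].

Definition expi (R : realType) (t : R) : R[i] := Complex (cos t) (sin t).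

(* Only the values [v n k] with [k <= n] are constrained. *)
Definition is_exp_coef (R : realType) (P : nat -> {poly R})
    (v : nat -> nat -> R) : Prop :=
  forall (n : nat) (t : R),
    expi (n%:R * t) * real_complex R (P n).[cos t]
    = \sum_(k < n.+1) real_complex R (v n k) * expi ((2 * k)%:R * t).

(* Main.v *)
(* With x = cos t, the weight on [0, pi] becomes
   h t = (arcsin (cos t) / cos t) * sin t, with moments
   a m = int_0^pi cos (2 m t) (h t) dt.  Since h t * cos t = (pi/2 - t) sin t,
   a m + a m.+1 = pi / (2 (m+1)) - pi / (2 m) for m > 0 and a 0 + a 1 = pi / 2.
   As a m tends to 0 this forces a m < 0 for m > 0, and telescoping gives
   a 0 + 2 (a 1 + ... + a m) = pi / (2 m) + a m > 0.
   So the Toeplitz matrix (a |i - j|) of size n + 1 has negative off-diagonal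
   entries and positive row sums.  Orthogonality of P n to the Chebyshev
   polynomials of degree < n says that this matrix maps the vector v n to
   c (e_0 + e_n); the minimum principle for such matrices, together with
   sum_k v n k = (P n).[1] = 1, excludes c <= 0 and gives v n k > 0. *)
Require Import Defs.
From HB Require Import structures.
From mathcomp Require Import all_boot all_order all_algebra.
From mathcomp Require Import complex.
From mathcomp Require Import all_classical all_reals all_analysis.
From mathcomp Require Import ring lra zify.

Import Order.TTheory GRing.Theory Num.Theory.
Import numFieldNormedType.Exports.
Local Open Scope classical_set_scope.
Local Open Scope ring_scope.

(* Minimum principle: look at the row of a smallest entry of [u]. *)
Lemma Mmatrix_mulmx_gt0 {R : realDomainType} (n : nat) (A : 'M[R]_n) (u : 'cV[R]_n) :
  (forall i j, i != j -> A i j < 0) -> (forall i, 0 < \sum_j A i j) ->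
  (forall i, 0 <= (A *m u) i 0) -> u != 0 -> forall i, 0 < u i 0.
Proof.
move=> A_offdiag A_row Au_ge0 u_neq0 i0.
case: (arg_minP (fun i => u i 0) (erefl : xpredT i0)) => i _ u_min.
apply: lt_le_trans (u_min i0 isT).
rewrite ltNge; apply/negP => ui_le0; move/eqP: u_neq0; apply.
(* If [u i 0 <= 0], both summands are nonpositive while their sum is nonnegative, so both vanish.
   The first then gives [u i 0 = 0], the second that every other entry equals it, so [u = 0]. *)
have Au_split : (A *m u) i 0 =
    u i 0 * (\sum_j A i j) + \sum_(j | j != i) A i j * (u j 0 - u i 0).
  have -> : \sum_(j | j != i) A i j * (u j 0 - u i 0) =
            \sum_j A i j * (u j 0 - u i 0).
    by rewrite [RHS](bigD1 i)//= subrr mulr0 add0r.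
  rewrite mxE mulr_sumr -big_split /=; apply: eq_bigr => j _; ring.
have offdiag_le0 j : j != i -> A i j * (u j 0 - u i 0) <= 0.
  move=> ji; rewrite nmulr_rle0 ?subr_ge0 ?u_min//.
  by rewrite A_offdiag// eq_sym.
have sum_le0 : \sum_(j | j != i) A i j * (u j 0 - u i 0) <= 0 by exact: sumr_le0.
have diag_le0 : u i 0 * (\sum_j A i j) <= 0 by rewrite mulr_le0_ge0// ltW.
have /eqP : u i 0 * (\sum_j A i j) = 0.
  by have := Au_ge0 i; rewrite Au_split => ?; lra.
rewrite mulf_eq0 (gt_eqF (A_row i)) orbF => /eqP ui0.
have /eqP : \sum_(j | j != i) - (A i j * (u j 0 - u i 0)) = 0.
  by have := Au_ge0 i; rewrite Au_split sumrN => ?; lra.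
rewrite psumr_eq0 => [/allP off0|j ji]; last by rewrite oppr_ge0 offdiag_le0.
apply/matrixP => j k; rewrite ord1 [RHS]mxE.
have [->//|ji] := eqVneq j i.
have := off0 j; rewrite mem_index_enum ji ui0 subr0 oppr_eq0 mulf_eq0 => /(_ isT).
by rewrite lt_eqF ?A_offdiag 1?eq_sym//= => /eqP.
Qed.

(** * Continuity of the weight, up to the end points *)

(** For [cos] followed by the weight: the weight is controlled only on [[-1, 1]], but [cos] never
    leaves that interval. *)
Lemma continuous_comp_within {R : realType} (f g : R -> R) (B : set R) :
  continuous f -> (forall x, B (f x)) -> {within B, continuous g} ->
  continuous (g \o f).
Proof.
move=> cf fB /subspace_continuousP cg x V /= Vgfx.
have := cg _ (fB x) V Vgfx; rewrite !nbhs_simpl/= /within/= => gV.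
have := cf x _ gV; apply: (@filterS _ (nbhs x)) => y /=; apply; exact: fB.
Qed.

(** Obtained as continuity of the inverse of [sin] on a segment, because differentiability of [asin]
    fails at the end points. *)
Lemma within_continuous_asin {R : realType} :
  {within `[-1, 1], continuous (@asin R)}.
Proof.
have : {within `[sin (- (pi / 2)), sin (pi / 2)], continuous (@asin R)}.
  apply: segment_can_le_continuous.
  - by have := @pihalf_ge1 R; lra.
  - by apply: continuous_subspaceT; exact: continuous_sin.
  - exact: sinK.
by rewrite sinN sin_pihalf.
Qed.

Lemma asin0 {R : realType} : asin 0 = 0 :> R.
Proof.
rewrite -[X in asin X]sin0 sinK// in_itv/=.
by have := @pihalf_ge1 R; move=> ?; apply/andP; split; lra.
Qed.

Lemma arcsin_weight_mul {R : realType} (x : R) : arcsin_weight x * x = asin x.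
Proof.
rewrite /arcsin_weight; case: eqP => [->|/eqP x0]; first by rewrite asin0 mulr0.
by rewrite divfK.
Qed.

(** Away from 0 the weight is the difference quotient of [asin] at 0, whose limit is the derivative
    1. *)
Lemma continuous_arcsin_weight0 {R : realType} :
  {for 0, continuous (@arcsin_weight R)}.
Proof.
have d0 : is_derive (0 : R) 1 (@asin R) 1.
  apply: is_derive_eq; first by apply: is_derive1_asin; lra.
  by rewrite expr0n/= subr0 sqrtr1 invr1.
have [dasin0 Dasin0] := d0.
have : (fun h : R => h^-1 *: (asin (h *: 1 + 0) - asin 0)) @ 0^' --> (1 : R).
  by rewrite -[X in _ --> X]Dasin0; exact: dasin0.
move=> cvg1; apply/continuous_withinNx.
rewrite [X in _ --> X]/arcsin_weight eqxx.
apply: cvg_trans cvg1; apply: near_eq_cvg.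
near=> h.
have h0 : h != 0 by near: h; exact: nbhs_dnbhs_neq.
by rewrite /arcsin_weight (negPf h0) scaler1 addr0 asin0 subr0 mulrC.
Unshelve. all: by end_near. Qed.

Lemma within_continuous_arcsin_weight {R : realType} :
  {within `[-1, 1], continuous (@arcsin_weight R)}.
Proof.
apply/subspace_continuousP => x x11.
have [->|x0] := eqVneq x 0.
  by apply: cvg_within_filter; exact: continuous_arcsin_weight0.
rewrite [X in _ --> X]/arcsin_weight (negPf x0).
have : asin y / y @[y --> within `[-1, 1] (nbhs x)] --> asin x / x.
  apply: cvgM.
    by move: x x11 {x0}; apply/subspace_continuousP; exact: within_continuous_asin.
  by apply: cvg_within_filter; apply: cvgV => //; exact: cvg_id.
apply: cvg_trans; apply: near_eq_cvg.
apply: cvg_within.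
near=> h.
have h0 : h != 0.
  by near: h; exact: open_neq.
by rewrite /from_subspace/arcsin_weight (negPf h0).
Unshelve. all: by end_near. Qed.

(** The function [h] of the overview; [sin t] is the Jacobian of [x = cos t]. *)
Definition circle_weight {R : realType} (t : R) := arcsin_weight (cos t) * sin t.

Lemma continuous_circle_weight {R : realType} : continuous (@circle_weight R).
Proof.
move=> t; apply: cvgM; last exact: continuous_sin.
apply: (@continuous_comp_within R cos (@arcsin_weight R) `[-1, 1]).
- exact: continuous_cos.
- by move=> x; rewrite /= in_itv/= cos_geN1 cos_le1.
- exact: within_continuous_arcsin_weight.
Qed.

(** The factor [cos t] cancels the denominator, and [asin (cos t) = pi / 2 - t] on [[0, pi]]. *)
Lemma circle_weightMcos {R : realType} (t : R) : 0 <= t <= pi ->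
  circle_weight t * cos t = (pi / 2 - t) * sin t.
Proof.
move=> t0pi; rewrite /circle_weight mulrAC arcsin_weight_mul; congr (_ * _).
have -> : cos t = sin (pi / 2 - t).
  by rewrite sinB sin_pihalf cos_pihalf mul1r mul0r subr0.
by rewrite sinK// in_itv/=; lra.
Qed.

(** * Integration over [[0, pi]] and the substitution [x = cos t] *)

Definition int0pi {R : realType} (f : R -> R) : R :=
  \int[lebesgue_measure]_(t in `[0, pi]) f t.

Lemma integrable_int0pi {R : realType} (f : R -> R) : continuous f ->
  lebesgue_measure.-integrable `[0, pi] (EFin \o f).
Proof.
move=> cf; apply: continuous_compact_integrable; first exact: segment_compact.
exact: continuous_subspaceT.
Qed.

Lemma int0piD {R : realType} (f g : R -> R) : continuous f -> continuous g ->
  int0pi (fun t => f t + g t) = int0pi f + int0pi g.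
Proof. by move=> cf cg; rewrite /int0pi RintegralD//; exact: integrable_int0pi. Qed.

Lemma int0piZ {R : realType} (c : R) (f : R -> R) : continuous f ->
  int0pi (fun t => c * f t) = c * int0pi f.
Proof. by move=> cf; rewrite /int0pi RintegralZl//; exact: integrable_int0pi. Qed.

Lemma eq_int0pi {R : realType} (f g : R -> R) :
  (forall t, 0 <= t <= pi -> f t = g t) -> int0pi f = int0pi g.
Proof.
move=> fg; apply: eq_Rintegral => t; rewrite inE/= in_itv/=; exact: fg.
Qed.

Lemma continuous_sumf {R : realType} (I : Type) (s : seq I) (f : I -> R -> R) :
  (forall i, continuous (f i)) -> continuous (fun t => \sum_(i <- s) f i t).
Proof.
move=> cf; elim: s => [|i s IHs].
  under [fun t => _]eq_fun do rewrite big_nil.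
  exact: cst_continuous.
under [fun t => _]eq_fun do rewrite big_cons.
by move=> t; apply: cvgD; [exact: cf|exact: IHs].
Qed.

Lemma int0pi_sum {R : realType} (I : Type) (s : seq I) (c : I -> R)
    (f : I -> R -> R) : (forall i, continuous (f i)) ->
  int0pi (fun t => \sum_(i <- s) c i * f i t) = \sum_(i <- s) c i * int0pi (f i).
Proof.
move=> cf; have ccf i : continuous (fun t => c i * f i t).
  by move=> t; apply: cvgM; [exact: cvg_cst|exact: cf].
elim: s => [|i s IHs].
  under [fun t => _]eq_fun do rewrite big_nil.
  by rewrite big_nil /int0pi Rintegral_cst// mul0r.
under [fun t => _]eq_fun do rewrite big_cons.
by rewrite big_cons int0piD ?IHs ?int0piZ//; exact: continuous_sumf.
Qed.

Lemma int0pi_ge0 {R : realType} (f : R -> R) : (forall t, 0 <= f t) -> 0 <= int0pi f.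
Proof. by move=> f0; apply: Rintegral_ge0 => t _. Qed.

Lemma int0pi_FTC {R : realType} (F f : R -> R) : continuous f ->
  (forall t : R, is_derive t 1 F (f t)) -> int0pi f = F pi - F 0.
Proof.
move=> cf dF.
have cF : continuous F.
  move=> t; apply/differentiable_continuous/derivable1_diffP.
  by case: (dF t).
rewrite /int0pi /Rintegral (@continuous_FTC2 _ f F)//.
- exact: pi_gt0.
- exact: continuous_subspaceT.
- split => [t _||]; first by case: (dF t).
    by apply: cvg_at_right_filter; exact: cF.
  by apply: cvg_at_left_filter; exact: cF.
- by move=> t _; rewrite derive1E; case: (dF t).
Qed.

(** Change of variables along the decreasing map [cos] from [[0, pi]] onto [[-1, 1]]. Continuity on
    the closed interval makes [g] integrable there, so the two end points can be added. *)
Lemma int0pi_cosE {R : realType} (g : R -> R) :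
  {within `[-1, 1], continuous g} ->
  \int[lebesgue_measure]_(x in `]-1, 1[) g x = int0pi (fun t => g (cos t) * sin t).
Proof.
move=> cg.
have ig : lebesgue_measure.-integrable `[-1, 1] (EFin \o g).
  by apply: continuous_compact_integrable => //; exact: segment_compact.
rewrite Rintegral_itv_bndo_bndc; last first.
  by apply: integrableS ig => //; exact: subset_itv_oo_cc.
rewrite Rintegral_itv_obnd_cbnd; last first.
  by apply: integrableS ig => //; exact: subset_itv_oc_cc.
have d1 : derive1 (@cos R) = - sin.
  by apply/funext => t; rewrite derive1E derive_val.
rewrite /int0pi /Rintegral; congr fine.
have := @integration_by_substitution_decreasing R cos g 0 pi (pi_ge0 R).
rewrite cospi cos0 => ->//.
- by apply: eq_integral => t _; rewrite d1 /= opprK.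
- by move=> s t s0 t0 st; rewrite ltr_cos.
- by move=> t _; rewrite d1; apply: cvgN; exact: continuous_sin.
- rewrite d1; apply/cvg_ex; exists (- sin 0).
  by apply: cvgN; apply: cvg_at_right_filter; exact: continuous_sin.
- rewrite d1; apply/cvg_ex; exists (- sin pi).
  by apply: cvgN; apply: cvg_at_left_filter; exact: continuous_sin.
- split => [t _||]; first exact: derivable_cos.
    by apply: cvg_at_right_filter; exact: continuous_cos.
  by apply: cvg_at_left_filter; exact: continuous_cos.
Qed.

(** * Trigonometric integrals *)

Lemma continuous_cosM {R : realType} (c : R) : continuous (fun t => cos (c * t)).
Proof.
move=> t; apply: continuous_comp; last exact: continuous_cos.
exact: mulrl_continuous.
Qed.

Lemma continuous_sinM {R : realType} (c : R) : continuous (fun t => sin (c * t)).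
Proof.
move=> t; apply: continuous_comp; last exact: continuous_sin.
exact: mulrl_continuous.
Qed.

Lemma cos_natpi2 {R : realType} (m : nat) : cos ((2 * m)%:R * pi) = 1 :> R.
Proof.
rewrite mulr_natl; elim: m => [|m IHm]; first by rewrite muln0 mulr0n cos0.
by rewrite mulnS mulrnDr addrC cosD2pi.
Qed.

Lemma sin_natpi2 {R : realType} (m : nat) : sin ((2 * m)%:R * pi) = 0 :> R.
Proof.
rewrite mulr_natl; elim: m => [|m IHm]; first by rewrite muln0 mulr0n sin0.
by rewrite mulnS mulrnDr addrC sinD2pi.
Qed.

Lemma int0pi_cos {R : realType} (m : nat) :
  int0pi (fun t : R => cos ((2 * m)%:R * t)) = pi *+ (m == 0)%N.
Proof.
case: m => [|m].
  under [fun t => _]eq_fun do rewrite muln0 mul0r cos0.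
  rewrite (@int0pi_FTC _ id) ?subr0//.
  exact: cst_continuous.
set c : R := (2 * m.+1)%:R; have c0 : c != 0 by rewrite pnatr_eq0.
have dF (t : R) : is_derive t 1 (fun t => sin (c * t) / c) (cos (c * t)).
  apply: is_derive_eq; rewrite /GRing.scale/=.
  by field.
rewrite (int0pi_FTC _ _ _ dF); last exact: continuous_cosM.
by rewrite sin_natpi2 mulr0 sin0 !mul0r subr0.
Qed.

(* At [m = 0] both sides are 0, by division by zero on the right. *)
Lemma int0pi_sawtooth_sin {R : realType} (m : nat) :
  int0pi (fun t : R => (pi / 2 - t) * sin ((2 * m)%:R * t)) = pi / (2 * m)%:R.
Proof.
case: m => [|m].
  under [fun t => _]eq_fun do rewrite muln0 mul0r sin0 mulr0.
  by rewrite /int0pi Rintegral_cst// invr0 mul0r mulr0.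
set c : R := (2 * m.+1)%:R; have c0 : c != 0 by rewrite pnatr_eq0.
(* Antiderivative found by integration by parts. *)
have dF (t : R) : is_derive t 1
    (fun t => - ((pi / 2 - t) * cos (c * t) / c) - sin (c * t) / c ^+ 2)
    ((pi / 2 - t) * sin (c * t)).
  apply: is_derive_eq; rewrite /GRing.scale/=.
  by field.
rewrite (int0pi_FTC _ _ _ dF).
  by rewrite cos_natpi2 sin_natpi2 !mulr0 cos0 sin0; field.
move=> t; apply: cvgM; last exact: continuous_sinM.
by apply: cvgB; [exact: cvg_cst|exact: cvg_id].
Qed.

Lemma int0pi_cos_orthogonal {R : realType} (l m : nat) :
  int0pi (fun t : R => cos ((2 * l.+1)%:R * t) * cos ((2 * m.+1)%:R * t))
  = pi / 2 *+ (l == m).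
Proof.
(* The order makes the truncated [m - l] below a true difference. *)
wlog lm : l m / (l <= m)%N => [wlog_lm|].
  have [|/ltnW ml] := leqP l m; first exact: wlog_lm.
  rewrite [l == m]eq_sym -(wlog_lm _ _ ml).
  by apply: eq_int0pi => t _; rewrite mulrC.
have -> : int0pi (fun t : R => cos ((2 * l.+1)%:R * t) * cos ((2 * m.+1)%:R * t))
    = int0pi (fun t : R => 2^-1 * (cos ((2 * (m - l))%:R * t)
                                 + cos ((2 * (m + l).+2)%:R * t))).
  apply: eq_int0pi => t _.
  have -> : (2 * (m - l))%:R * t = (2 * m.+1)%:R * t - (2 * l.+1)%:R * t.
    by rewrite -mulrBl -natrB; [congr (_%:R * _); lia|lia].
  have -> : (2 * (m + l).+2)%:R * t = (2 * m.+1)%:R * t + (2 * l.+1)%:R * t.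
    by rewrite -mulrDl -natrD; congr (_%:R * _); lia.
  by rewrite cosB cosD; field.
rewrite int0piZ; last first.
  by move=> t; apply: cvgD; exact: continuous_cosM.
rewrite int0piD; [|exact: continuous_cosM..].
rewrite !int0pi_cos /= addr0 subn_eq0 eqn_leq lm/=.
by case: leqP => _; rewrite ?mulr0n ?mulr0 ?mulr1n; field.
Qed.

(** * Bessel inequality and Riemann-Lebesgue lemma *)

Lemma Bessel_int0pi {R : realType} (f : R -> R) (N : nat) : continuous f ->
  \sum_(m < N) (int0pi (fun t => cos ((2 * m.+1)%:R * t) * f t)) ^+ 2
  <= pi / 2 * int0pi (fun t => f t ^+ 2).
Proof.
move=> cf; set c := fun m : nat => int0pi (fun t => cos ((2 * m.+1)%:R * t) * f t).
pose e (m : nat) (t : R) := cos ((2 * m.+1)%:R * t).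
have ce m : continuous (e m) by exact: continuous_cosM.
have cM (g h : R -> R) : continuous g -> continuous h ->
    continuous (fun t => g t * h t) by move=> cg ch t; apply: cvgM; [exact: cg|exact: ch].
set S := \sum_(m < N) _; set F := int0pi _.
have pi2_gt0 : 0 < pi / 2 :> R by have := @pi_gt0 R; lra.
(* [g] is [f] minus its orthogonal projection on the [e m], whose squared norm is [pi / 2]. The
   inequality says that the squared norm of [g] is nonnegative. *)
pose g t := f t + (-1) * \sum_(m < N) (c m / (pi / 2)) * e m t.
have : 0 <= int0pi (fun t => g t ^+ 2) by apply: int0pi_ge0 => t; exact: sqr_ge0.
have -> : int0pi (fun t => g t ^+ 2) = int0pi (fun t => f t ^+ 2
   + (\sum_(m < N) (- 2 * c m / (pi / 2)) * (e m t * f t)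
     + \sum_(m < N) (c m / (pi / 2)) *
          (\sum_(l < N) (c l / (pi / 2)) * (e m t * e l t)))).
  apply: eq_int0pi => t _; rewrite /g.
  have -> : \sum_(m < N) (- 2 * c m / (pi / 2)) * (e m t * f t) =
      - 2 * f t * \sum_(m < N) (c m / (pi / 2)) * e m t.
    by rewrite mulr_sumr; apply: eq_bigr => m _; ring.
  have -> : \sum_(m < N) (c m / (pi / 2)) *
          (\sum_(l < N) (c l / (pi / 2)) * (e m t * e l t)) =
      (\sum_(m < N) (c m / (pi / 2)) * e m t) ^+ 2.
    rewrite expr2 mulr_suml; apply: eq_bigr => m _.
    by rewrite [LHS]mulr_sumr [RHS]mulr_sumr; apply: eq_bigr => l _; ring.
  ring.
have cmul2 m l : continuous (fun t => e m t * e l t) by exact: cM.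
have csum1 : continuous (fun t => \sum_(m < N) (- 2 * c m / (pi / 2)) * (e m t * f t)).
  apply: continuous_sumf => m; apply: (cM); [exact: cst_continuous|exact: cM].
have csum2 m : continuous (fun t => \sum_(l < N) (c l / (pi / 2)) * (e m t * e l t)).
  apply: continuous_sumf => l; apply: (cM); [exact: cst_continuous|exact: cM].
have csum3 : continuous (fun t => \sum_(m < N) (c m / (pi / 2)) *
          (\sum_(l < N) (c l / (pi / 2)) * (e m t * e l t))).
  apply: continuous_sumf => m; apply: (cM); [exact: cst_continuous|exact: csum2].
rewrite int0piD//; [|exact: cM|by move=> t; apply: cvgD; [exact: csum1|exact: csum3]].
rewrite int0piD// int0pi_sum; last by move=> m; exact: cM.
rewrite int0pi_sum//.
under [X in _ + (_ + X)]eq_bigr => m _.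
  rewrite int0pi_sum//.
  under eq_bigr => l _ do rewrite int0pi_cos_orthogonal.
  rewrite (bigD1 m)//= eqxx big1 ?addr0; last first.
    move=> l lm; have /negPf -> : (m != l :> nat) by rewrite eq_sym.
    by rewrite mulr0n mulr0.
  over.
rewrite -big_split/=.
(* The cross terms contribute [-2 S / (pi / 2)] and the squared projection [S / (pi / 2)]. *)
have -> : \sum_(m < N) (- 2 * c m / (pi / 2) * c m +
    c m / (pi / 2) * (c m / (pi / 2) * (pi / 2 *+ true))) = - (S / (pi / 2)).
  rewrite /S mulr_suml -sumrN; apply: eq_bigr => m _; rewrite -/(c m) mulr1n.
  by field; lra.
by rewrite subr_ge0 ler_pdivrMr// mulrC.
Qed.

(** By Bessel the squares of the coefficients form a convergent series, so they tend to 0. *)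
Lemma Riemann_Lebesgue_int0pi {R : realType} (f : R -> R) : continuous f ->
  int0pi (fun t => cos ((2 * m)%:R * t) * f t) @[m --> \oo] --> 0.
Proof.
(* The shift drops [m = 0], as Bessel is stated for positive frequencies only. *)
move=> cf; rewrite -cvg_shiftS.
set c := fun m : nat => _.
have : cvgn (series (fun m => c m ^+ 2)).
  apply: nondecreasing_is_cvgn.
    by apply: nondecreasing_series => m _ _; exact: sqr_ge0.
  exists (pi / 2 * int0pi (fun t => f t ^+ 2)) => _ [N _ <-].
  by rewrite /series/= big_mkord; exact: Bessel_int0pi.
move=> /cvg_series_cvg_0 c2; apply/norm_cvg0P.
have -> : (fun m => `|c m|) = (fun m => Num.sqrt (c m ^+ 2)).
  by apply/funext => m; rewrite sqrtr_sqr.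
rewrite -[X in _ --> X]sqrtr0.
by apply: (cvg_comp _ _ c2); exact: sqrt_continuous.
Qed.

(** * The moments: recurrence, signs and partial sums *)

Definition circle_moment {R : realType} (m : nat) : R :=
  int0pi (fun t => cos ((2 * m)%:R * t) * circle_weight t).

(* At [m = 0] the last term is [pi / 0 = 0]. *)
Lemma circle_momentDS {R : realType} (m : nat) :
  circle_moment m + circle_moment m.+1
  = pi / (2 * m.+1)%:R - pi / (2 * m)%:R :> R.
Proof.
have cch n : continuous (fun t : R => cos ((2 * n)%:R * t) * circle_weight t).
  by move=> t; apply: cvgM; [exact: continuous_cosM|exact: continuous_circle_weight].
have cpi n : continuous (fun t : R => (pi / 2 - t) * sin ((2 * n)%:R * t)).
  move=> t; apply: cvgM; last exact: continuous_sinM.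
  by apply: cvgB; [exact: cvg_cst|exact: cvg_id].
rewrite -!int0pi_sawtooth_sin /circle_moment -int0piD// -mulN1r -int0piZ// -int0piD//.
  apply: eq_int0pi => t t0pi; rewrite -mulrDl.
  (* With the middle frequency [s = (2m + 1) t], the two cosines add up to [2 cos s cos t]. The
     factor [cos t] turns the weight into [(pi / 2 - t) sin t], and [2 cos s sin t] is a difference
     of sines. *)
  have -> : (2 * m)%:R * t = (2 * m).+1%:R * t - t by rewrite -[in RHS]natr1; ring.
  have -> : (2 * m.+1)%:R * t = (2 * m).+1%:R * t + t.
    by rewrite mulnS add2n -[in LHS]natr1; ring.
  rewrite cosB cosD sinB sinD.
  transitivity (2 * cos ((2 * m).+1%:R * t) * (circle_weight t * cos t)); first ring.
  by rewrite circle_weightMcos//; ring.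
by move=> t; apply: cvgM; [exact: cvg_cst|exact: cpi].
Qed.

(* Convexity of [1 / m] makes [a m < a m.+2 < ...], and this sequence tends to 0. *)
Lemma circle_momentS_lt0 {R : realType} (m : nat) : circle_moment m.+1 < 0 :> R.
Proof.
pose a (n : nat) : R := circle_moment n.
have a_incr n : a n.+1 < a n.+3.
  have e1 : a n.+1 + a n.+2 = _ := circle_momentDS n.+1.
  have e2 : a n.+2 + a n.+3 = _ := circle_momentDS n.+2.
  (* The two recurrences share [a n.+2], so it is enough to compare their right-hand sides. *)
  suff : pi / (2 * n.+2)%:R - pi / (2 * n.+1)%:R
         < pi / (2 * n.+3)%:R - pi / (2 * n.+2)%:R :> R.
    by rewrite -e1 -e2 [ltRHS]addrC ltrD2r.
  have n0 : 0 <= n%:R :> R by exact: ler0n.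
  rewrite -subr_gt0.
  have -> : pi / (2 * n.+3)%:R - pi / (2 * n.+2)%:R -
      (pi / (2 * n.+2)%:R - pi / (2 * n.+1)%:R) =
      pi / ((n%:R + 1) * (n%:R + 2) * (n%:R + 3)) :> R.
    rewrite !natrM -[n.+3]addn3 -[n.+2]addn2 -[n.+1]addn1 !natrD.
    by field; rewrite !lt0r_neq0//; lra.
  by rewrite divr_gt0 ?pi_gt0// !mulr_gt0//; lra.
(* The first increase supplies strictness; the terms from [a m.+3] on, in steps of two, only need to
   stay below their limit 0. *)
apply: (lt_le_trans (a_incr m)).
have cvg_a : (fun k : nat => a (m.+3 + 2 * k)%N) @ \oo --> (0 : R).
  have := @Riemann_Lebesgue_int0pi R _ continuous_circle_weight.
  apply: cvg_comp; apply/cvgnyPge => A; near=> k.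
  suff : (A <= k)%N by lia.
  by near: k; exact: nbhs_infty_ge.
have nd : nondecreasing_seq (fun k : nat => a (m.+3 + 2 * k)%N).
  apply/nondecreasing_seqP => k; apply/ltW.
  have -> : (m.+3 + 2 * k.+1 = (m.+2 + 2 * k).+3)%N by lia.
  by have -> : (m.+3 + 2 * k = (m.+2 + 2 * k).+1)%N by lia.
have := nondecreasing_cvgn_le nd (cvgP _ cvg_a) 0.
by rewrite muln0 addn0 (cvg_lim _ cvg_a).
Unshelve. all: by end_near. Qed.

(** Telescoping of the recurrence; at [m = 0] the quotient is 0 by division by zero. *)
Lemma circle_moment_sum {R : realType} (m : nat) :
  circle_moment 0 + 2 * (\sum_(i < m) circle_moment i.+1)
  = pi / (2 * m)%:R + circle_moment m :> R.
Proof.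
elim: m => [|m IHm].
  by rewrite big_ord0 muln0 invr0 !mulr0 addr0 add0r.
rewrite big_ord_recr/= mulrDr addrA IHm.
rewrite -[pi / (2 * m.+1)%:R](subrK (pi / (2 * m)%:R)) -circle_momentDS; ring.
Qed.

Lemma circle_moment_sum_gt0 {R : realType} (m : nat) :
  0 < circle_moment 0 + 2 * (\sum_(i < m) circle_moment i.+1) :> R.
Proof.
have gt0S k : 0 < circle_moment 0 + 2 * (\sum_(i < k.+1) circle_moment i.+1) :> R.
  (* In [pi / (2 * k.+1) + a k.+1] the moment is negative; one more use of the recurrence replaces
     it by a difference of visible sign. *)
  have -> : circle_moment 0 + 2 * (\sum_(i < k.+1) circle_moment i.+1) =
      pi / (2 * k.+2)%:R - circle_moment k.+2 :> R.
    rewrite circle_moment_sum -[circle_moment k.+1](addrK (circle_moment k.+2)).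
    by rewrite circle_momentDS; ring.
  by rewrite subr_gt0 (lt_le_trans (circle_momentS_lt0 _))// divr_ge0 ?pi_ge0.
(* For the empty sum: [a 0 + 2 a 1 > 0] and [a 1 < 0] give [a 0 > 0]. *)
case: m => [|m //]; have := gt0S 0; rewrite big_ord1 big_ord0.
have := @circle_momentS_lt0 R 0; lra.
Qed.

(* The truncated [(i - j) + (j - i)] is the distance [|i - j|]. *)
Lemma sum_distn {V : zmodType} (F : nat -> V) (n i : nat) : (i <= n)%N ->
  \sum_(j < n.+1) F ((i - j) + (j - i))%N
  = \sum_(k < i) F k.+1 + (F 0%N + \sum_(k < n - i) F k.+1).
Proof.
move=> /subnKC <-; rewrite addKn -addnS big_split_ord/=; congr (_ + _).
  rewrite (reindex_inj rev_ord_inj); apply: eq_bigr => k _ /=.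
  by congr F; have := ltn_ord k; lia.
rewrite big_ord_recl/=; congr (F _ + _); first lia.
by apply: eq_bigr => k _; congr F; rewrite /bump/=; lia.
Qed.

(** * The Toeplitz matrix of the moments *)

Definition moment_mx {R : realType} (n : nat) : 'M[R]_n.+1 :=
  \matrix_(i, j) circle_moment ((i - j) + (j - i))%N.

Lemma moment_mx_offdiag {R : realType} (n : nat) (i j : 'I_n.+1) :
  i != j -> @moment_mx R n i j < 0.
Proof.
rewrite -val_eqE/= mxE => ij.
have -> : ((i - j) + (j - i) = ((i - j) + (j - i)).-1.+1)%N by lia.
exact: circle_momentS_lt0.
Qed.

(** Twice the sum of row [i] is the sum of the two positive quantities of [circle_moment_sum_gt0]
    for [i] and for [n - i]. *)
Lemma moment_mx_row_gt0 {R : realType} (n : nat) (i : 'I_n.+1) :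
  0 < \sum_j @moment_mx R n i j.
Proof.
under eq_bigr do rewrite mxE.
rewrite sum_distn ?leq_ord//.
have := @circle_moment_sum_gt0 R i; have := @circle_moment_sum_gt0 R (n - i).
set a := \sum_(k < _) _; set b := \sum_(k < _) _; set c := circle_moment 0.
move: a b c => a b c; lra.
Qed.

(** * Chebyshev polynomials and orthogonality to lower degrees *)

Lemma exists_Chebyshev {R : realType} (m : nat) :
  exists2 q : {poly R}, (size q <= m.+1)%N & forall t, q.[cos t] = cos (m%:R * t).
Proof.
(* Two consecutive degrees are carried along for the recurrence
   [T (m + 2) = 2 X T (m + 1) - T m]. *)
suff [//] : (exists2 q : {poly R}, (size q <= m.+1)%N &
      forall t, q.[cos t] = cos (m%:R * t)) /\
    (exists2 q : {poly R}, (size q <= m.+2)%N &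
      forall t, q.[cos t] = cos (m.+1%:R * t)).
elim: m => [|m [[p sp pE] [q sq qE]]].
  split; [exists 1; rewrite ?size_poly1//|exists 'X; rewrite ?size_polyX//] => t.
    by rewrite hornerC mul0r cos0.
  by rewrite hornerX mul1r.
split; first by exists q.
exists (2%:P * 'X * q - p) => [|t].
  rewrite (leq_trans (size_polyD _ _))// size_polyN geq_max (leq_trans sp) ?andbT; last lia.
  rewrite -mulrA mul_polyC (leq_trans (size_scale_leq _ _))//.
  by rewrite (leq_trans (size_polyMleq _ _))// size_polyX; lia.
rewrite !hornerE pE qE.
have -> : m%:R * t = m.+1%:R * t - t by rewrite -[in RHS]natr1; ring.
have -> : m.+2%:R * t = m.+1%:R * t + t by rewrite -[in LHS]natr1; ring.
rewrite cosB cosD; ring.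
Qed.

Definition circle_functional {R : realType} (p : {poly R}) : R :=
  int0pi (fun t => p.[cos t] * circle_weight t).

Lemma continuous_horner_cos {R : realType} (p : {poly R}) :
  continuous (fun t => p.[cos t] * circle_weight t).
Proof.
move=> t; apply: cvgM; last exact: continuous_circle_weight.
apply: (@continuous_comp _ _ _ cos (horner p)); first exact: continuous_cos.
exact: continuous_horner.
Qed.

Lemma circle_functionalDZ {R : realType} (c : R) (p q : {poly R}) :
  circle_functional (c *: p + q) = c * circle_functional p + circle_functional q.
Proof.
rewrite /circle_functional -int0piZ; last exact: continuous_horner_cos.
rewrite -int0piD.
- by apply: eq_int0pi => t _; rewrite hornerD hornerZ; ring.
- by move=> t; apply: cvgM; [exact: cvg_cst|exact: continuous_horner_cos].
- exact: continuous_horner_cos.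
Qed.

Lemma Rintegral_arcsin_weight {R : realType} (p : {poly R}) :
  \int[lebesgue_measure]_(x in `]-1, 1[) (p.[x] * arcsin_weight x)
  = circle_functional p.
Proof.
rewrite int0pi_cosE; last first.
  move=> x; apply: cvgM; last exact: within_continuous_arcsin_weight.
  by apply: continuous_subspaceT; exact: continuous_horner.
by apply: eq_int0pi => t _; rewrite /circle_weight mulrA.
Qed.

(** Induction on the size of [q]: subtracting the multiple of [P m] with the same leading term, [m]
    being the degree of [q], lowers the size, and [P m] is orthogonal to [P n] since [m < n]. *)
Lemma circle_functional_lower {R : realType} (P : nat -> {poly R}) (n : nat)
    (q : {poly R}) :
  is_normalized_orthopoly (@arcsin_weight R) P -> (size q <= n)%N ->
  circle_functional (P n * q) = 0.
Proof.
move=> [sizeP orthoP _]; have [k] := ubnP (size q).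
elim: k q => // k IHk q; rewrite ltnS => size_q_k size_q_n.
have [->|q0] := eqVneq q 0.
  have := circle_functionalDZ (-1) (P n * 0) (P n * 0).
  by rewrite mulN1r addNr mulr0 scaler0 addr0.
set m := (size q).-1.
have size_qE : size q = m.+1 by rewrite prednK// size_poly_gt0.
pose c := lead_coef q / lead_coef (P m).
have Pm0 : lead_coef (P m) != 0 by rewrite lead_coef_eq0 -size_poly_gt0 sizeP.
have size_r : (size (q - c *: P m)%R < size q)%N.
  rewrite size_qE ltnS; apply/leq_sizeP => j; rewrite leq_eqVlt => /predU1P[<-|mj].
    rewrite coefB coefZ /c /lead_coef sizeP -/m /= divfK ?subrr//.
    by move: Pm0; rewrite /lead_coef sizeP.
  rewrite coefB coefZ !nth_default ?mulr0 ?subr0// ?sizeP//.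
  by rewrite size_qE.
have -> : P n * q = c *: (P m * P n) + P n * (q - c *: P m).
  by rewrite mulrBr -scalerAr [P m * P n]mulrC addrC subrK.
rewrite circle_functionalDZ IHk; last 2 first.
- exact: leq_trans size_r size_q_k.
- exact: leq_trans (ltnW size_r) size_q_n.
rewrite -Rintegral_arcsin_weight addr0.
under eq_Rintegral => x _ do rewrite hornerM.
by rewrite orthoP ?mulr0//; lia.
Qed.

(** * The linear system satisfied by the coefficients *)

(** Real part of the defining identity multiplied by [expi (- 2 l t)]; as [cos] is even, the
    frequencies may be written as distances. *)
Lemma exp_coef_cos {R : realType} (P : nat -> {poly R}) (v : nat -> nat -> R)
    (n l : nat) (t : R) : is_exp_coef P v ->
  \sum_(k < n.+1) v n k * cos ((2 * ((l - k) + (k - l)))%:R * t)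
  = (P n).[cos t] * cos ((n - 2 * l + (2 * l - n))%:R * t).
Proof.
move=> /(_ n t) coefv.
have cos_distn i j : cos ((i - j + (j - i))%:R * t) = cos (i%:R * t - j%:R * t).
  have [ij|/ltnW ji] := leqP i j.
    rewrite -[RHS]cosN opprB -mulrBl -natrB//; congr (cos (_%:R * _)); lia.
  by rewrite -mulrBl -natrB//; congr (cos (_%:R * _)); lia.
have ReD (y z : R[i]) : complex.Re (y + z) = complex.Re y + complex.Re z.
  by case: y z => [? ?] [].
have ImD (y z : R[i]) : complex.Im (y + z) = complex.Im y + complex.Im z.
  by case: y z => [? ?] [].
have reE : cos (n%:R * t) * (P n).[cos t]
    = \sum_(k < n.+1) v n k * cos ((2 * k)%:R * t).
  have := congr1 (@complex.Re R) coefv; rewrite (big_morph _ ReD erefl)/= mulr0 subr0 => ->.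
  by apply: eq_bigr => k _; rewrite mul0r subr0.
have imE : sin (n%:R * t) * (P n).[cos t]
    = \sum_(k < n.+1) v n k * sin ((2 * k)%:R * t).
  have := congr1 (@complex.Im R) coefv; rewrite (big_morph _ ImD erefl)/= mulr0 add0r => ->.
  by apply: eq_bigr => k _; rewrite mul0r addr0.
rewrite cos_distn cosB.
transitivity (cos (n%:R * t) * (P n).[cos t] * cos ((2 * l)%:R * t)
    + sin (n%:R * t) * (P n).[cos t] * sin ((2 * l)%:R * t)); last by ring.
rewrite reE imE !mulr_suml -big_split/=; apply: eq_bigr => k _.
have -> : (2 * (l - k + (k - l)) = 2 * k - 2 * l + (2 * l - 2 * k))%N by lia.
by rewrite cos_distn cosB; ring.
Qed.

(** Entry [l] is the integral of [P n] times the Chebyshev polynomial of degree [|n - 2l|]. This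
    degree is [n] for [l = 0] and [l = n], and smaller otherwise, where orthogonality gives 0. *)
Lemma moment_mx_exp_coef {R : realType} (P : nat -> {poly R}) (v : nat -> nat -> R)
    (n : nat) : is_normalized_orthopoly (@arcsin_weight R) P -> is_exp_coef P v ->
  exists c, forall l : 'I_n.+1,
    (moment_mx n *m \col_k v n k) l 0 = c *+ ((l == 0%N :> nat) || (l == n :> nat)).
Proof.
move=> orthoP coefv.
have [q size_q qE] := @exists_Chebyshev R n.
exists (circle_functional (P n * q)) => l.
have [r size_r rE] := @exists_Chebyshev R (n - 2 * l + (2 * l - n)).
have -> : (moment_mx n *m \col_k v n k) l 0 = circle_functional (P n * r).
  rewrite mxE; under eq_bigr do rewrite !mxE mulrC.
  rewrite /circle_moment -int0pi_sum; last first.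
    by move=> k t; apply: cvgM; [exact: continuous_cosM|exact: continuous_circle_weight].
  apply: eq_int0pi => t _.
  rewrite hornerM rE -(exp_coef_cos P v n l t coefv) mulr_suml.
  by apply: eq_bigr => k _; rewrite mulrA.
have [l0n|] := boolP ((l == 0%N :> nat) || (l == n :> nat)).
  apply: eq_int0pi => t _; rewrite !hornerM rE qE.
  by congr (_ * cos (_%:R * _) * _); case/orP: l0n => /eqP ->; lia.
have := ltn_ord l; rewrite negb_or => ln /andP[l0 ln'].
by rewrite (circle_functional_lower P n r orthoP)// (leq_trans size_r)//; lia.
Qed.

Theorem theorem1p1 (R : realType) (P : nat -> {poly R}) (v : nat -> nat -> R)
    (orthoP : is_normalized_orthopoly (@arcsin_weight R) P)
    (coefv : is_exp_coef P v) (n k : nat) (le_kn : (k <= n)%N) :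
  0 < v n k.
Proof.
have [c Au] := moment_mx_exp_coef P v n orthoP coefv.
set u := \col_k v n k in Au.
have sum_v : \sum_(j < n.+1) v n j = 1.
  (* At [l = 0] and [t = 0] all cosines are 1 and the right-hand side is the normalized value at
     1. *)
  have := @exp_coef_cos R P v n 0 0 coefv.
  rewrite mulr0 cos0 mulr1; case: orthoP => _ _ -> <-.
  by apply: eq_bigr => j _; rewrite mulr0 cos0 mulr1.
have u0 : u != 0.
  apply: contra_eq_neq sum_v => u0.
  rewrite big1 => [|j _]; first by rewrite eq_sym oner_eq0.
  by have /matrixP/(_ j 0) := u0; rewrite !mxE.
have u_gt0 (w : 'cV[R]_n.+1) : w != 0 -> (forall l, 0 <= (moment_mx n *m w) l 0) ->
    forall i, 0 < w i 0.
  move=> w0 Aw.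
  exact: (Mmatrix_mulmx_gt0 _ _ _ (moment_mx_offdiag n) (moment_mx_row_gt0 n) Aw w0).
(* For [c >= 0] the minimum principle applies to [u]. Otherwise it applies to [- u], making every
   coefficient negative, against their sum 1. *)
have [c_ge0|/ltW c_le0] := leP 0 c.
  have := u_gt0 u u0 _ (inord k); rewrite mxE inordK ?ltnS//; apply => l.
  by rewrite Au mulrn_wge0.
have Nu_gt0 (j : 'I_n.+1) : v n j < 0.
  have := u_gt0 (- u); rewrite oppr_eq0 => /(_ u0) Nu.
  suff : 0 < (- u) j 0 by rewrite !mxE oppr_gt0.
  by apply: Nu => l; rewrite mulmxN mxE oppr_ge0 Au mulrn_wle0.
have : \sum_(j < n.+1) v n j <= 0 by apply: sumr_le0 => j _; exact/ltW.
by rewrite sum_v leNgt ltr01.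
Qed.
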